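(* Assume CH. Then the forcing poset consisting of all finite coherent adequate subsets of $\mathcal X$, ordered by inclusion (a condition $B$ extends $A$ iff $A\subseteq B$), satisfies the $\omega_2$-chain condition.
   Context: Fix a cardinal $\lambda\ge\omega_2$ of uncountable cofinality and a predicate $Y\subseteq H(\lambda)$ coding a well-ordering of $H(\lambda)$. Let $\mathcal X$ be the set of all countable $N\subseteq H(\lambda)$ with $(N,\in,Y\cap N)\prec(H(\lambda),\in,Y)$. Let $\Lambda=\omega_2\cap\mathrm{cof}(\omega_1)$. For $M\in\mathcal X$ let $\Lambda_M$ be the set of $\beta\in\Lambda$ with $\beta=\min(\Lambda\setminus\sup(M\cap\beta))$; for $M,N\in\mathcal X$, $\beta_{M,N}$ denotes the largest element of $\Lambda_M\cap\Lambda_N$. Write $M<N$ if $M\cap\beta_{M,N}\in N$; $M\sim N$ if $M\cap\beta_{M,N}=N\cap\beta_{M,N}$. $A\subseteq\mathcal X$ is adequate if for all $M,N\in A$, $M<N$, $M\sim N$ or $N<M$. An isomorphism between $M,N\in\mathcal X$ is a bijection $\sigma:M\to N$ preserving $\in$ and membership in $Y$ in both directions; if it exists it is unique, denoted $\sigma_{M,N}$, and $M,N$ are called isomorphic. $M\cong N$ (strongly isomorphic) means isomorphic with $\sigma_{M,N}(a)=a$ for all $a\in M\cap N$. $A\subseteq\mathcal X$ is coherent adequate if adequate and for all $M,N\in A$: (1) $M\sim N$ implies $M\cong N$; (2) if $M<N$ there is $N'\in A$ isomorphic to $N$ with $M\in N'$; (3) if $M,N$ isomorphic and $K\in M\cap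 A$ then $\sigma_{M,N}(K)\in A$. *)

(* Defs.v *)
From Stdlib Require Import Relation_Operators.
From HB Require Import structures.
From mathcomp Require Import all_boot generic_quotient.
From mathcomp Require Import boolp classical_sets functions cardinality.

Set Implicit Arguments.
Unset Strict Implicit.
Unset Printing Implicit Defensive.

Local Open Scope classical_set_scope.
Local Open Scope card_scope.
Local Open Scope quotient_scope.

(* The universe of sets: Aczel's well-founded trees modulo bisimulation, so   *)
(* that equality of sets is Leibniz equality.                                 *)

Inductive tree : Type := Tree (I : Type) of I -> tree.

Fixpoint bisim (s t : tree) : Prop :=
  match s, t with
  | Tree J f, Tree K g =>
      (forall i, exists j, bisim (f i) (g j)) /\
      (forall j, exists i, bisim (f i) (g j))
  end.

Lemma bisim_refl s : bisim s s.
Proof. by elim: s => I f IH; split=> i; exists i. Qed.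

Lemma bisim_sym s t : bisim s t -> bisim t s.
Proof.
elim: s t => I f IH [J g] [fg gf]; split=> [j|i].
- by have [i /IH] := gf j; exists i.
- by have [j /IH] := fg i; exists j.
Qed.

Lemma bisim_trans t s u : bisim s t -> bisim t u -> bisim s u.
Proof.
elim: s t u => I f IH [J g] [K h] [fg gf] [gh hg]; split=> [i|k].
- by have [j fgj] := fg i; have [k ghk] := gh j; exists k; apply: IH fgj ghk.
- by have [j ghj] := hg k; have [i fgi] := gf j; exists i; apply: IH fgi ghj.
Qed.

HB.instance Definition _ := gen_eqMixin tree.
HB.instance Definition _ := gen_choiceMixin tree.

Definition bisimb : rel tree := fun s t => `[< bisim s t >].

Lemma bisimb_refl : reflexive bisimb.
Proof. by move=> s; apply/asboolP/bisim_refl. Qed.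

Lemma bisimb_sym : symmetric bisimb.
Proof. by move=> s t; apply/asboolP/asboolP; apply: bisim_sym. Qed.

Lemma bisimb_trans : transitive bisimb.
Proof.
by move=> t s u /asboolP st /asboolP tu; apply/asboolP/(bisim_trans st tu).
Qed.

Canonical bisim_equiv := EquivRel bisimb bisimb_refl bisimb_sym bisimb_trans.

Definition V := {eq_quot bisim_equiv}.

Definition set_of (I : Type) (f : I -> V) : V := \pi_V (Tree (fun i => repr (f i))).

Definition idx (x : V) : Type := let: Tree J _ := repr x in J.

Definition child (x : V) : idx x -> V :=
  match repr x as t return (let: Tree J _ := t in J) -> V with
  | Tree J f => fun i => \pi_V (f i)
  end.

Definition isin (x y : V) : Prop := exists i : idx y, child i = x.
Notation "x ∈ y" := (isin x y) (at level 70).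

Definition elts (x : V) : set V := [set y | y ∈ x].

Lemma piV_eq (s t : tree) : \pi_V s = \pi_V t <-> bisim s t.
Proof.
split=> [st|st].
  by apply/asboolP; change (bisim_equiv s t); rewrite -eqmodE; apply/eqP.
by apply/eqP; rewrite eqmodE /=; apply/asboolP.
Qed.

Lemma isin_pi (x : V) I (f : I -> tree) :
  x ∈ \pi_V (Tree f) <-> exists i, \pi_V (f i) = x.
Proof.
have : bisim (repr (\pi_V (Tree f))) (Tree f) by apply/piV_eq; rewrite reprK.
rewrite /isin /child /idx; case: (repr _) => J g [gf fg]; split=> [[j <-]|[i <-]].
- by have [i gfi] := gf j; exists i; apply/piV_eq/bisim_sym.
- by have [j gfj] := fg i; exists j; apply/piV_eq.
Qed.

Lemma in_set_of I (f : I -> V) x : x ∈ set_of f <-> exists i, f i = x.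
Proof. by rewrite isin_pi; split=> -[i <-]; exists i; rewrite reprK. Qed.

Lemma set_of_child x : set_of (@child x) = x.
Proof.
rewrite -[RHS]reprK /set_of /child /idx; case: (repr x) => I f.
by apply/piV_eq; split=> i; exists i; apply/piV_eq; rewrite reprK.
Qed.

Lemma V_ext x y : (forall z, z ∈ x <-> z ∈ y) -> x = y.
Proof.
rewrite -[x]reprK -[y]reprK; case: (repr x) (repr y) => I f [J g] fg.
apply/piV_eq; split=> [i|j].
- have /isin_pi [j e] : \pi_V (f i) ∈ \pi_V (Tree g).
    by apply/fg/isin_pi; exists i.
  by exists j; apply/bisim_sym/piV_eq.
- have /isin_pi [i e] : \pi_V (g j) ∈ \pi_V (Tree f).
    by apply/fg/isin_pi; exists j.
  by exists i; apply/piV_eq.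
Qed.

Lemma V_ind (P : V -> Prop) :
  (forall x, (forall y, y ∈ x -> P y) -> P x) -> forall x, P x.
Proof.
move=> IH x; rewrite -[x]reprK; elim: (repr x) => I f IHf.
by apply: IH => y /isin_pi [i <-].
Qed.

Definition sep (x : V) (P : set V) : V :=
  set_of (fun i : {i : idx x | P (child i)} => child (sval i)).

Lemma in_sep x P z : z ∈ sep x P <-> z ∈ x /\ P z.
Proof.
rewrite in_set_of; split=> [[[i Pi] /= <-]|[[i <-] Pi]]; last by exists (exist _ i Pi).
by split=> //; exists i.
Qed.

Definition inter (x y : V) : V := sep x (elts y).

Lemma in_inter x y z : z ∈ inter x y <-> z ∈ x /\ z ∈ y.
Proof. exact: in_sep. Qed.

(* The remaining axioms of ZF in V (choice is inherited from the metatheory); *)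
(* replacement holds for all meta-level functions, so classes included in a   *)
(* set, and functions defined on a set, are represented below by meta-level   *)
(* predicates [set V] and functions [V -> V].                                 *)

Lemma V_pairing x y : exists p, forall z, z ∈ p <-> z = x \/ z = y.
Proof.
exists (set_of (fun b : bool => if b then x else y)) => z; rewrite in_set_of.
by split=> [[[] <-]|[]->]; [left|right|exists true|exists false].
Qed.

Lemma V_union x : exists u, forall z, z ∈ u <-> exists2 y, y ∈ x & z ∈ y.
Proof.
exists (set_of (fun p : {i : idx x & idx (child i)} => child (projT2 p))) => z.
rewrite in_set_of; split=> [[[i j] /= <-]|[y [i <-] [j <-]]].
- by exists (child i); [exists i|exists j].
- by exists (existT _ i j).
Qed.

Lemma V_powerset x : exists p, forall z, z ∈ p <-> elts z `<=` elts x.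
Proof.
exists (set_of (fun b : idx x -> bool =>
  set_of (fun i : {i | b i} => child (sval i)))) => z; rewrite in_set_of.
split=> [[b <-] y /in_set_of [i <-]|zx]; first by exists (sval i).
exists (fun i => `[< child i ∈ z >]); apply: V_ext => y; rewrite in_set_of.
split=> [[[i /= /asboolP iz] <- //]|yz].
have [i iy] := zx _ yz.
have bi : `[< child i ∈ z >] by apply/asboolP; rewrite iy.
by exists (exist _ i bi).
Qed.

Lemma V_replacement x (F : V -> V) :
  exists r, forall z, z ∈ r <-> exists2 y, y ∈ x & z = F y.
Proof.
exists (set_of (fun i : idx x => F (child i))) => z; rewrite in_set_of.
split=> [[i <-]|[y [i <-] ->]]; last by exists i.
by exists (child i) => //; exists i.
Qed.

Lemma V_infinity : exists w, (exists2 e, e ∈ w & forall z, ~ z ∈ e) /\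
  forall x, x ∈ w -> exists2 s, s ∈ w & forall z, z ∈ s <-> z ∈ x \/ z = x.
Proof.
pose succ x := set_of (fun o : option (idx x) => if o is Some i then child i else x).
pose num n := iter n succ (set_of (fun i : void => match i with end)).
exists (set_of num); split.
  by exists (num 0); [apply/in_set_of; exists 0|move=> z /in_set_of [[]]].
move=> _ /in_set_of [n <-]; exists (num n.+1); first by apply/in_set_of; exists n.+1.
move=> z; rewrite in_set_of; split=> [[[i|] <-]|[[i <-]|->]].
- by left; exists i.
- by right.
- by exists (Some i).
- by exists None.
Qed.

Definition strict_well_order (A : set V) (R : V -> V -> Prop) : Prop :=
  [/\ forall a, A a -> ~ R a a,
      forall a b c, A a -> A b -> A c -> R a b -> R b c -> R a c,
      forall a b, A a -> A b -> [\/ R a b, a = b | R b a]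
    & forall B : set V, B `<=` A -> B !=set0 ->
        exists2 m, B m & forall b, B b -> b = m \/ R m b].

Definition transitive_set (x : V) : Prop := forall y, y ∈ x -> elts y `<=` elts x.

Definition ordinal (x : V) : Prop :=
  transitive_set x /\ strict_well_order (elts x) isin.

Definition cardinal (k : V) : Prop :=
  ordinal k /\ forall a, a ∈ k -> ~ (elts a #= elts k).

Definition card_lt T U (A : set T) (B : set U) : Prop := A #<= B /\ ~ (B #<= A).

(* The ordinals omega_1 and omega_2, given by their extensions. *)
Definition omega1 : set V := [set a | ordinal a /\ countable (elts a)].
Definition omega2 : set V := [set a | ordinal a /\ elts a #<= omega1].

Definition CH : Prop := [set: set nat] #= omega1.

Definition cofinal_in (C : set V) (a : V) : Prop :=
  C `<=` elts a /\ forall b, b ∈ a -> exists2 c, C c & b = c \/ b ∈ c.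

(* The least cardinality of a cofinal subset of the ordinal a is that of K. *)
Definition cofinality_is (a : V) (K : set V) : Prop :=
  (exists2 C, cofinal_in C a & C #= K) /\ forall C, cofinal_in C a -> K #<= C.

Definition uncountable_cofinality (a : V) : Prop :=
  forall C, cofinal_in C a -> ~ countable C.

Definition trcl (x : V) : set V := [set y | clos_trans V isin y x].

Definition H (lam : V) : set V := [set x | card_lt (trcl x) (elts lam)].

(* First-order formulas in the language of structures (D, ∈, Y), with de      *)
(* Bruijn indices: the quantifier binds index 0.                              *)
Inductive formula : Type :=
| FIn of nat & nat
| FEq of nat & nat
| FPred of nat
| FNot of formula
| FAnd of formula & formula
| FEx of formula.

Definition scons (x : V) (e : nat -> V) : nat -> V :=
  fun n => if n is m.+1 then e m else x.

Fixpoint sat (D Y : set V) (e : nat -> V) (p : formula) : Prop :=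
  match p with
  | FIn i j => e i ∈ e j
  | FEq i j => e i = e j
  | FPred i => Y (e i)
  | FNot q => ~ sat D Y e q
  | FAnd q r => sat D Y e q /\ sat D Y e r
  | FEx q => exists2 x, D x & sat D Y (scons x e) q
  end.

(* (N, ∈, Y ∩ N) is an elementary substructure of (D, ∈, Y). *)
Definition elementary (N D Y : set V) : Prop :=
  [/\ N !=set0, N `<=` D
    & forall p e, (forall n, N (e n)) -> (sat N (Y `&` N) e p <-> sat D Y e p)].

(* Y codes a well-ordering of D: some well-ordering of D is definable without *)
(* parameters in (D, ∈, Y). The indices >= 2, to which b is assigned, are not *)
(* meant to occur in p, and any such occurrence is harmless.                  *)
Definition codes_well_order (D Y : set V) : Prop :=
  exists p, strict_well_order D
    (fun a b => sat D Y (scons a (fun _ => b)) p).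

Definition XX (lam : V) (Y : set V) : set V :=
  [set N | countable (elts N) /\ elementary (elts N) (H lam) Y].

Definition least (A : set V) (a : V) : Prop :=
  A a /\ forall b, A b -> b = a \/ a ∈ b.

Definition largest (A : set V) (a : V) : Prop :=
  A a /\ forall b, A b -> b = a \/ b ∈ a.

(* The supremum of a set of ordinals is its union. *)
Definition osup (A : set V) : set V := [set y | exists2 x, A x & y ∈ x].

Definition Lambda : set V := [set b | omega2 b /\ cofinality_is b omega1].

Definition Lambda_of (M : V) : set V :=
  [set b | least (Lambda `\` osup (elts M `&` elts b)) b].

(* b is the ordinal beta_{M,N}. *)
Definition is_beta (M N b : V) : Prop := largest (Lambda_of M `&` Lambda_of N) b.

Definition ltX (M N : V) : Prop := exists2 b, is_beta M N b & inter M b ∈ N.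

Definition simX (M N : V) : Prop := exists2 b, is_beta M N b & inter M b = inter N b.

Definition adequate (A : set V) : Prop :=
  forall M N, A M -> A N -> [\/ ltX M N, simX M N | ltX N M].

Definition isomorphism (Y : set V) (M N : V) (s : V -> V) : Prop :=
  [/\ set_bij (elts M) (elts N) s,
      forall a b, a ∈ M -> b ∈ M -> (a ∈ b <-> s a ∈ s b)
    & forall a, a ∈ M -> (Y a <-> Y (s a))].

Definition isomorphic (Y : set V) (M N : V) : Prop :=
  exists s, isomorphism Y M N s.

Definition strongly_isomorphic (Y : set V) (M N : V) : Prop :=
  exists2 s, isomorphism Y M N s & forall a, a ∈ M -> a ∈ N -> s a = a.

Definition coherent_adequate (Y A : set V) : Prop :=
  [/\ adequate A,
      forall M N, A M -> A N -> simX M N -> strongly_isomorphic Y M N,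
      forall M N, A M -> A N -> ltX M N ->
        exists N', [/\ A N', isomorphic Y N' N & M ∈ N']
    & forall M N s K, A M -> A N -> isomorphism Y M N s ->
        K ∈ M -> A K -> A (s K)].

Definition PP (lam : V) (Y : set V) : set (set V) :=
  [set A | [/\ finite_set A, A `<=` XX lam Y & coherent_adequate Y A]].

(* [ext p q] reads: p extends q. *)
Definition compatible T (P : set T) (ext : T -> T -> Prop) (p q : T) : Prop :=
  exists r, [/\ P r, ext r p & ext r q].

Definition antichain T (P : set T) (ext : T -> T -> Prop) (W : set T) : Prop :=
  W `<=` P /\ forall p q, W p -> W q -> p <> q -> ~ compatible P ext p q.

Definition omega2_cc T (P : set T) (ext : T -> T -> Prop) : Prop :=
  forall W, antichain P ext W -> W #<= omega1.

(* Main.v *)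
From Stdlib Require Import Relation_Operators.
From mathcomp Require Import all_boot.
From mathcomp Require Import boolp classical_sets functions cardinality.
Require Import Defs.

Set Implicit Arguments.
Unset Strict Implicit.
Unset Printing Implicit Defensive.

Local Open Scope classical_set_scope.
Local Open Scope card_scope.

(* Let W be an antichain of size greater than omega_1. Enumerate the union of *)
(* each condition A in W as e_A : nat -> V; the isomorphism type of A along   *)
(* e_A is a real. By CH there is a set S of size omega_1 which is closed      *)
(* under countable sequences in the following sense: its trace on omega_2 is  *)
(* an ordinal, it contains min (Lambda \ sup x) for every countable x in S,   *)
(* and whenever some condition of W has a given type and prescribed values    *)
(* in S at a given set of indices, S contains the union of such a condition.  *)
(* (S is generated by operations of countable arity, so its elements are      *)
(* named by well-founded countably branching trees, which are coded by reals; *)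
(* no elementary chain is needed.) Take B in W that is not one of the omega_1 *)
(* conditions chosen for S, and let A be the condition chosen for the type of *)
(* B and the part of e_B lying in S. The isomorphism e_A n |-> e_B n fixes    *)
(* the common elements, and the new ordinals of B lie above S. Hence, for M   *)
(* in A and N in B with image M' of M in B, the ordinal beta_{M,N} is at most *)
(* beta_{M',N}, and M, M' agree below it; so M and N compare exactly as M'    *)
(* and N do, and A `|` B is itself a condition extending A and B.             *)

(** The combinatorial core is [linked_union]: two conditions of one type, agreeing on their common
    part and on everything below a common point of their Lambda-sets, have a condition as union.
    [PP_cc] finds two such members in any large family, CH entering through [card_generated] (few
    sets are generated) and [omega2_enum] (ordinals below omega_2 are indexed by reals).
    Elementarity contributes [XX_countable_sub] (countable members are subsets) and
    [inter_Lambda_notin] (no model contains its own initial segment). They make the three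
    comparisons mutually exclusive ([ltX_not_simX], [ltX_asym]), so a comparison between the two
    conditions can be read back inside one of them; [link_beta_le] is the pivot of that transfer. *)

Lemma card_le_surj T U (A : set T) (B : set U) (x0 : T) :
  A #<= B -> exists f : U -> T, A `<=` f @` B.
Proof.
case/pfcard_geP=> [->|]; first by exists (fun=> x0).
by case/surjfunPex=> f ->; exists f.
Qed.

Lemma surj_card_le T U (A : set T) (B : set U) (f : U -> T) :
  A `<=` f @` B -> A #<= B.
Proof. by move=> /subset_card_le /card_le_trans; apply; apply: card_image_le. Qed.

Lemma countable_enum T (A : set T) (x0 : T) :
  countable A -> exists e : nat -> T, A `<=` range e.
Proof. exact: card_le_surj. Qed.

Lemma countable_indexed T (A : set T) (x0 : T) :
  countable A -> exists (D : set nat) (e : nat -> T), A = e @` D.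
Proof.
move=> /(countable_enum x0) [e Ae]; exists (e @^-1` A), e.
apply/seteqP; split=> [x Ax|_ [n An <-] //].
by have [n _ enx] := Ae _ Ax; exists n => //=; rewrite enx.
Qed.

Lemma countable_sub T (A B : set T) : A `<=` B -> countable B -> countable A.
Proof. by move=> AB; apply/sub_countable/subset_card_le. Qed.

(** Hilbert's hotel: [X] contains a copy [f] of the naturals, whose even places are sent onto the
    whole copy and whose odd places are sent onto [C]. *)
Lemma card_setU_countable (X C : set V) :
  infinite_set X -> countable C -> X `|` C #<= X.
Proof.
move=> /infiniteP /(card_le_surj 0%N) [h hX] Ccount.
have /choice [f fP] n : exists x, X x /\ h x = n.
  by have [x] := hX n I; exists x.
have [c Cc] := countable_enum (f 0%N) Ccount.
have fK n : h (f n) = n by have [] := fP n.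
pose g x := if `[< x = f (h x) >] then
  (if odd (h x) then c (h x)./2 else f (h x)./2) else x.
apply: (@surj_card_le _ _ _ _ g) => y [Xy|Cy].
  case: (pselect (y = f (h y))) => yE; last by exists y => //; rewrite /g asboolF.
  exists (f (h y).*2); first by have [] := fP (h y).*2.
  by rewrite /g fK asboolT // odd_double doubleK -yE.
have [n _ <-] := Cc _ Cy.
exists (f n.*2.+1); first by have [] := fP n.*2.+1.
by rewrite /g fK asboolT //= odd_double /= uphalf_double.
Qed.

(** * Sets generated by operations of countable arity *)

(** Terms: [Node k l f] applies operation number [k], with the sequence [l] of reals as parameters,
    to countably many subterms. *)
Inductive wtree : Type :=
| Leaf
| Node of nat & (nat -> set nat) & (nat -> wtree).

(* A tree is determined by the list of the labels along its finite branches. *)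
Fixpoint wcode (w : wtree) (s : seq nat) (q : nat + nat * nat) : Prop :=
  match w, s with
  | Leaf, _ => False
  | Node k l f, [::] => match q with inl j => j = k | inr (i, n) => l i n end
  | Node k l f, n :: s' => wcode (f n) s' q
  end.

Lemma wcode_inj w1 w2 : (forall s q, wcode w1 s q <-> wcode w2 s q) -> w1 = w2.
Proof.
elim: w1 w2 => [|k l f IH] [|k' l' f'] // E.
- by have [_ /(_ erefl)] := E [::] (inl k').
- by have [/(_ erefl)] := E [::] (inl k).
have -> : k = k' by have [/(_ erefl)] := E [::] (inl k).
have -> : l = l'.
  by apply/funext => i; apply/funext => n; apply/propext; have := E [::] (inr (i, n)).
by congr Node; apply/funext => n; apply: IH => s q; have := E (n :: s) q.
Qed.

Lemma card_wtree : [set: wtree] #<= [set: set nat].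
Proof.
pose c w : set nat := [set m | exists s q, m = pickle (s, q) /\ wcode w s q].
have c_inj : injective c.
  have sub w w' s q : c w = c w' -> wcode w s q -> wcode w' s q.
    move=> E ws; have : c w (pickle (s, q)) by exists s, q.
    by rewrite E => -[s' [q' [/(pcan_inj pickleK) [-> ->]]]].
  by move=> w w' E; apply: wcode_inj => s q; split; apply: sub.
have /card_eqPle [_ le1] := @inj_card_eq _ _ [set: wtree] c (in2W c_inj).
exact: card_le_trans le1 (card_leT _).
Qed.

Section Closure.
Variables (F : nat -> (nat -> set nat) -> (nat -> V) -> V) (x0 : V).

Fixpoint weval (w : wtree) : V :=
  match w with Leaf => x0 | Node k l f => F k l (fun n => weval (f n)) end.

Definition generated : set V := range weval.

Lemma generated_seed : generated x0.
Proof. by exists Leaf. Qed.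

Lemma generated_op k l f : (forall n, generated (f n)) -> generated (F k l f).
Proof.
move=> fS; have /choice [g gP] n : exists w, weval w = f n.
  by have [w] := fS n; exists w.
by exists (Node k l g) => //=; congr F; apply/funext.
Qed.

Lemma card_generated : generated #<= [set: set nat].
Proof. exact: card_le_trans (card_image_le _ _) card_wtree. Qed.

End Closure.

(** * Ordinals *)

Lemma isin_irrefl x : ~ x ∈ x.
Proof. by elim/V_ind: x => x IH xx; apply: (IH x xx). Qed.

Lemma isin_asym x y : x ∈ y -> ~ y ∈ x.
Proof. by elim/V_ind: x y => x IH y xy yx; apply: (IH y yx x yx xy). Qed.

Lemma isin_minimal (P : set V) x : P x -> exists2 m, P m & forall y, y ∈ m -> ~ P y.
Proof.
elim/V_ind: x => x IH Px.
have [[y yx Py]|nP] := pselect (exists2 y, y ∈ x & P y); first exact: IH Py.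
by exists x => // y yx Py; apply: nP; exists y.
Qed.

Lemma ordinal_in a x : ordinal a -> x ∈ a -> ordinal x.
Proof.
move=> [atr [irr tr tri wf]] xa; have xsub := atr _ xa; split.
- move=> y yx z zy; apply: (tr z y x) => //; last exact: xsub.
  by apply: atr zy; apply: xsub.
- split=> [b /xsub|b c d /xsub ba /xsub ca /xsub|b c /xsub ba /xsub ca|B Bx B0].
  + exact: irr.
  + exact: tr.
  + exact: tri.
  + by apply: wf => // b /Bx /xsub.
Qed.

Lemma ordinal_trans a x y : ordinal a -> x ∈ a -> y ∈ x -> y ∈ a.
Proof. by move=> [atr _] xa yx; apply: atr yx. Qed.

Lemma ordinal_total a b : ordinal a -> ordinal b -> [\/ a ∈ b, a = b | b ∈ a].
Proof.
elim/V_ind: a b => a IHa b oa; elim/V_ind: b => b IHb ob.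
have [[x xa xb]|ab] := pselect (exists2 x, x ∈ a & ~ x ∈ b).
  have [//|xE|bx] := IHa x xa b (ordinal_in oa xa) ob.
  - by apply: Or33; rewrite -xE.
  - by apply: Or33; apply: ordinal_trans xa bx.
have [[y yb ya]|ba] := pselect (exists2 y, y ∈ b & ~ y ∈ a).
  have [ay|yE|//] := IHb y yb (ordinal_in ob yb).
  - by apply: Or31; apply: ordinal_trans yb ay.
  - by apply: Or31; rewrite yE.
apply: Or32; apply: V_ext => z; split=> zz; apply: contrapT => nz.
- by apply: ab; exists z.
- by apply: ba; exists z.
Qed.

Lemma ordinal_notin a b : ordinal a -> ordinal b -> ~ a ∈ b -> a = b \/ b ∈ a.
Proof. by move=> oa ob nab; case: (ordinal_total oa ob) => //; [left|right]. Qed.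

Lemma least_ordinal (P : set V) x :
  P `<=` ordinal -> P x -> exists a, least P a.
Proof.
move=> Po /isin_minimal [m Pm mmin]; exists m; split=> // b Pb.
by apply: ordinal_notin; [apply: Po|apply: Po|move=> /mmin].
Qed.

Lemma ordinal_of_transitive x :
  transitive_set x -> elts x `<=` ordinal -> ordinal x.
Proof.
move=> xtr xo; split=> //; split=> [a _|a b c ax bx cx ab bc|a b ax bx|B Bx [b Bb]].
- exact: isin_irrefl.
- by apply: ordinal_trans bc ab; apply: xo.
- exact: ordinal_total (xo _ ax) (xo _ bx).
- have [|m [Bm mmin]] := @least_ordinal B b _ Bb; first by move=> z /Bx /xo.
  by exists m.
Qed.

Lemma omega2_in a x : omega2 a -> x ∈ a -> omega2 x.
Proof.
move=> [oa a_le] xa; split; first exact: ordinal_in xa.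
apply: card_le_trans a_le; apply: subset_card_le => y yx.
exact: ordinal_trans yx.
Qed.

Lemma omega2_ordinal : omega2 `<=` ordinal.
Proof. by move=> a []. Qed.

Lemma Lambda_omega2 : Lambda `<=` omega2.
Proof. by move=> a []. Qed.

Lemma Lambda_ordinal : Lambda `<=` ordinal.
Proof. by move=> a /Lambda_omega2 /omega2_ordinal. Qed.

Definition vempty : V := set_of (fun i : void => match i with end).

Lemma in_vempty x : ~ x ∈ vempty.
Proof. by move=> /in_set_of [[]]. Qed.

Lemma isin_wf : well_founded isin.
Proof. by move=> x; elim/V_ind: x => x IH; split. Qed.

(* Recursion along omega_1, choosing at each step a point of C not yet used. *)
Lemma uncountable_omega1_le (C : set V) : ~ countable C -> omega1 #<= C.
Proof.
move=> Cunc.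
pose step (a : V) (h : forall b, b ∈ a -> V) :=
  xget vempty (C `\` [set z | exists b (ba : b ∈ a), z = h b ba]).
pose h := Fix isin_wf (fun=> V) step.
have hE a : h a = xget vempty (C `\` (h @` elts a)).
  rewrite /h Fix_eq => [|x f g fg]; last first.
    congr (xget vempty (_ `\` _)); apply/seteqP.
    by split=> _ [b [bx ->]]; exists b, bx.
  congr (xget vempty (_ `\` _)); apply/seteqP.
  by split=> [_ [b [ba ->]]|_ [b ba <-]]; [exists b|exists b, ba].
have hP a : omega1 a -> (C `\` (h @` elts a)) (h a).
  move=> [_ ca]; rewrite hE; apply: xgetPex; apply: contrapT => nex.
  apply: Cunc; apply: countable_sub (sub_countable (card_image_le h _) ca).
  by move=> x Cx; apply: contrapT => nx; apply: nex; exists x.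
have hinj : {in omega1 &, injective h}.
  move=> a b /set_mem oa /set_mem ob ab.
  have [in_ab|//|in_ba] := ordinal_total oa.1 ob.1.
  - by have [_] := hP b ob; case; exists a.
  - by have [_] := hP a oa; case; exists b.
have /card_eqPle [_ le1] := inj_card_eq hinj.
apply: card_le_trans le1 (subset_card_le _) => _ [a /hP [Ca _] <-].
exact: Ca.
Qed.

(** * Points of [Lambda] under CH and the existence of beta *)

Section Lam.
Variable lam : V.
Hypothesis lam_ge : omega2 `<=` elts lam.

(** [omega2] is given as a class; separation inside [lam] turns its subclasses into sets. *)
Lemma in_sep_omega2 (P : set V) z : P `<=` omega2 -> z ∈ sep lam P <-> P z.
Proof. by move=> Po; rewrite in_sep; split=> [[]|Pz] //; split=> //; apply/lam_ge/Po. Qed.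

Lemma omega1_omega2 : omega1 `<=` omega2.
Proof.
move=> a [oa ca]; split=> //; apply: subset_card_le => x xa; split.
- exact: ordinal_in xa.
- by apply: countable_sub ca => y yx; apply: ordinal_trans yx.
Qed.

(** Burali-Forti: a countable [omega1] would be an ordinal belonging to itself. *)
Lemma omega1_uncountable : ~ countable omega1.
Proof.
move=> c1; pose o1 := sep lam omega1.
have in_o1 z : z ∈ o1 <-> omega1 z by apply/in_sep_omega2/omega1_omega2.
suff : omega1 o1 by move=> /in_o1 /isin_irrefl.
split; last by apply: countable_sub c1 => z /in_o1.
apply: ordinal_of_transitive => [y /in_o1 [oy cy] z zy|y /in_o1 []//].
apply/in_o1; split; first exact: ordinal_in zy.
by apply: countable_sub cy => u uz; apply: ordinal_trans uz.
Qed.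

(** Otherwise [b] is at most [d], hence countable, although it is cofinal in itself. *)
Lemma omega1_in_Lambda b d : Lambda b -> omega1 d -> d ∈ b.
Proof.
move=> [[ob _] [_ cof]] [od cd]; apply: contrapT => /(ordinal_notin od ob) db.
have le1 : omega1 #<= elts b by apply: cof; split=> // x xb; exists x => //; left.
apply: omega1_uncountable; apply: sub_countable le1 _.
apply: countable_sub cd => x xb; case: db => [->//|bd].
exact: ordinal_trans xb.
Qed.

Hypothesis ch : CH.

Lemma reals_le_omega1 : [set: set nat] #<= omega1.
Proof. by case/card_eqPle: ch. Qed.

Lemma omega1_le_reals : omega1 #<= [set: set nat].
Proof. by case/card_eqPle: ch. Qed.

(** One uniform [p] makes passing to an element of an ordinal an operation with a real parameter. *)
Lemma omega2_enum : exists p : V -> set nat -> V,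
  forall a x, omega2 a -> x ∈ a -> exists l, p a l = x.
Proof.
suff /choice [p pP] : forall a, exists q : set nat -> V,
    omega2 a -> forall x, x ∈ a -> exists l, q l = x.
  by exists p => a x oa; apply: pP.
move=> a; have [oa|?] := pselect (omega2 a); last by exists (fun=> a).
have [q qP] := card_le_surj (vempty) (card_le_trans oa.2 omega1_le_reals).
by exists q => _ x /qP [l _ <-]; exists l.
Qed.

(** Closure under [p] makes the trace of [S] on omega_2 transitive, hence an ordinal; CH bounds its
    size. *)
Lemma omega2_of_closed (p : V -> set nat -> V) (S : set V) :
    (forall a x, omega2 a -> x ∈ a -> exists l, p a l = x) ->
    S #<= [set: set nat] -> (forall a l, S a -> S (p a l)) ->
  omega2 (sep lam (S `&` omega2)).
Proof.
move=> pP Sle Sp.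
have inS z : z ∈ sep lam (S `&` omega2) <-> (S `&` omega2) z.
  by apply: in_sep_omega2 => ? [].
split.
  apply: ordinal_of_transitive => [y /inS [Sy oy] z zy|y /inS [_ /omega2_ordinal]//].
  apply/inS; split; last exact: omega2_in zy.
  by have [l <-] := pP _ _ oy zy; apply: Sp.
apply: (card_le_trans (B := S)); first by apply: subset_card_le => z /inS [].
exact: card_le_trans Sle reals_le_omega1.
Qed.

Lemma omega2_bound (g : nat -> V) :
  exists2 b, omega2 b & forall n, omega2 (g n) -> g n ∈ b.
Proof.
have [p pP] := omega2_enum.
pose F k (l : nat -> set nat) f := if k is k'.+1 then g k' else p (f 0%N) (l 0%N).
pose S := generated F vempty.
exists (sep lam (S `&` omega2)).
  apply: (omega2_of_closed pP); first exact: card_generated.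
  by move=> a l Sa; apply: (@generated_op F vempty 0 (fun=> l) (fun=> a)).
move=> n on; apply/in_sep_omega2; first by move=> ? [].
split=> //; apply: (@generated_op F vempty n.+1 (fun=> set0) (fun=> vempty)) => _.
exact: generated_seed.
Qed.

(** Closing under bounds [u] of countable sequences gives [b] uncountable cofinality; as its size is
    at most omega_1, the cofinality is omega_1. *)
Lemma Lambda_bound (X : set V) : countable X -> X `<=` omega2 ->
  exists2 b, Lambda b & X `<=` elts b.
Proof.
move=> /(countable_enum vempty) [g gX] Xo.
have [p pP] := omega2_enum.
have /choice [u uP] (f : nat -> V) :
    exists b, omega2 b /\ forall n, omega2 (f n) -> f n ∈ b.
  by have [b] := omega2_bound f; exists b.
pose F k (l : nat -> set nat) f :=
  if k is k'.+2 then g k' else if k is 1 then u f else p (f 0%N) (l 0%N).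
pose S := generated F vempty.
pose b := sep lam (S `&` omega2).
have inb z : z ∈ b <-> (S `&` omega2) z by apply: in_sep_omega2 => ? [].
have Sseed : S vempty by apply: generated_seed.
have ob : omega2 b.
  apply: (omega2_of_closed pP); first exact: card_generated.
  by move=> a l Sa; apply: (@generated_op F vempty 0 (fun=> l) (fun=> a)).
have cofu C : cofinal_in C b -> omega1 #<= C.
  move=> [Cb Ccof]; apply: uncountable_omega1_le.
  move=> /(countable_indexed vempty) [D [e CE]].
  pose f n := if `[< D n >] then e n else vempty.
  have Sf n : S (f n).
    rewrite /f; case: asboolP => // Dn.
    by have /inb [] : e n ∈ b by apply: Cb; rewrite CE; exists n.
  have Su : S (u f) by apply: (@generated_op F vempty 1 (fun=> set0) f).
  have [ou fu] := uP f.
  have [c] := Ccof (u f) ((inb _).2 (conj Su ou)).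
  move=> Cc; have /inb [_ oc] := Cb _ Cc.
  have cu : c ∈ u f.
    move: Cc oc; rewrite CE => -[n Dn <-] oc.
    by have := fu n; rewrite /f asboolT //; apply.
  by case=> [E|/(isin_asym cu)//]; move: cu; rewrite E => /isin_irrefl.
exists b; last first.
  move=> x Xx; apply/inb; split; last exact: Xo.
  have [n _ <-] := gX _ Xx.
  by apply: (@generated_op F vempty n.+2 (fun=> set0) (fun=> vempty)).
have cofb : cofinal_in (elts b) b by split=> // x xb; exists x => //; left.
split=> //; split=> //; exists (elts b) => //.
by apply/card_eqPle; split; [case: ob|exact: cofu].
Qed.

Lemma Lambda_least_above (X : set V) : countable X ->
  exists b, least (Lambda `\` osup (X `&` omega2)) b.
Proof.
move=> cX; have [||b Lb Xb] := @Lambda_bound (X `&` omega2).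
- by apply: countable_sub cX => ? [].
- by move=> ? [].
apply: (@least_ordinal _ b) => [x [/Lambda_ordinal]//|].
by split=> // -[x /Xb xb bx]; apply: isin_asym bx.
Qed.

(** This form shows that only the points of [M] below [b] matter. *)
Lemma Lambda_ofP M b : Lambda_of M b <-> Lambda b /\
  forall d, Lambda d -> d ∈ b -> exists2 x, x ∈ M & x ∈ b /\ d ∈ x.
Proof.
split=> [[[Lb _] bmin]|[Lb bP]].
  split=> // d Ld db; apply: contrapT => nx.
  have [|E|/(isin_asym db)//] := bmin d; last by move: db; rewrite E => /isin_irrefl.
  by split=> // -[x [xM xb] dx]; apply: nx; exists x.
split.
  by split=> // -[x [xM xb] /(isin_asym xb)].
move=> d [Ld nd]; apply: ordinal_notin; [exact: Lambda_ordinal..|].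
by move=> /(bP d Ld) [x xM [xb dx]]; apply: nd; exists x.
Qed.

(* The least upper bound in Lambda of Lambda_M and Lambda_N belongs to both. *)
Lemma beta_exists M N : countable (elts M) -> exists b, is_beta M N b.
Proof.
move=> cM.
have [||c Lc Mc] := @Lambda_bound (elts M `&` omega2).
- by apply: countable_sub cM => ? [].
- by move=> ? [].
(* The point [c] is such a bound because it exceeds all ordinals of [M] below omega_2. Nonemptiness
   of the intersection need not be known beforehand: the least bound is shown to lie in it. *)
pose ub := [set u | Lambda u /\ forall b, (Lambda_of M `&` Lambda_of N) b -> b = u \/ b ∈ u].
have Bord b : (Lambda_of M `&` Lambda_of N) b -> ordinal b.
  by move=> [/Lambda_ofP [/Lambda_ordinal]].
have ubc : ub c.
  split=> // b Bb; have [bc|->|cb] := ordinal_total (Bord b Bb) (Lambda_ordinal Lc).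
  - by right.
  - by left.
  have [/Lambda_ofP [Lb /(_ c Lc cb) [x xM [xb cx]]] _] := Bb.
  have /Mc xc : (elts M `&` omega2) x.
    by split=> //; apply: omega2_in xb; apply: Lambda_omega2.
  by have := isin_asym cx xc.
have [|u [[Lu uub] umin]] := @least_ordinal ub c _ ubc.
  by move=> x [/Lambda_ordinal].
have nub d : Lambda d -> d ∈ u -> exists2 b, (Lambda_of M `&` Lambda_of N) b & d ∈ b.
  move=> Ld du; apply: contrapT => nb.
  have [|E|/(isin_asym du)//] := umin d; last by move: du; rewrite E => /isin_irrefl.
  split=> // b Bb; have [bd|->|db] := ordinal_total (Bord b Bb) (Lambda_ordinal Ld).
  - by right.
  - by left.
  - by case: nb; exists b.
have subu b x : (Lambda_of M `&` Lambda_of N) b -> x ∈ b -> x ∈ u.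
  move=> /uub [->//|bu] xb.
  by apply: ordinal_trans bu xb; apply: Lambda_ordinal.
exists u; split=> //; split; apply/Lambda_ofP; split=> // d Ld du;
  have [b Bb db] := nub d Ld du; have [BM BN] := Bb.
- move/Lambda_ofP: BM => [_ /(_ d Ld db) [x xM [xb dx]]].
  by exists x => //; split=> //; apply: subu xb.
- move/Lambda_ofP: BN => [_ /(_ d Ld db) [x xM [xb dx]]].
  by exists x => //; split=> //; apply: subu xb.
Qed.

End Lam.

(** * Closure properties of countable elementary substructures *)

Lemma trcl_in x y : y ∈ x -> trcl x y.
Proof. exact: t_step. Qed.

Lemma trcl_trans x y z : trcl x y -> trcl y z -> trcl x z.
Proof. by move=> xy yz; apply: t_trans yz xy. Qed.

Lemma trcl_sub x (P : set V) : elts x `<=` P ->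
  (forall y z, P y -> z ∈ y -> P z) -> trcl x `<=` P.
Proof.
move=> xP Ptr y yx; elim: yx xP => [a b ab bP|a b c ab IHab bc IHbc cP].
  exact: bP.
by apply: IHab => z zb; apply: Ptr zb; apply: IHbc.
Qed.

Lemma trcl_subset x y : elts y `<=` elts x -> trcl y `<=` trcl x.
Proof.
move=> yx; apply: trcl_sub => [z /yx /trcl_in //|u z xu zu].
exact: trcl_trans xu (trcl_in zu).
Qed.

Lemma trcl_asym x y : trcl x y -> ~ trcl y x.
Proof.
elim/V_ind: x y => x IH y xy yx.
have : trcl x x := trcl_trans xy yx.
have tx : trcl x `<=` [set z | exists2 w, w ∈ x & w = z \/ trcl w z].
  apply: trcl_sub => [w wx|u z [w wx wu] zu]; first by exists w => //; left.
  exists w => //; right; case: wu => [->|wu]; first exact: trcl_in.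
  exact: trcl_trans wu (trcl_in zu).
move=> /tx [w wx [E|wx']]; first by move: wx; rewrite E => /isin_irrefl.
exact: IH (trcl_in wx).
Qed.

Lemma card_lt_le T U W (A : set T) (B : set U) (C : set W) :
  A #<= B -> card_lt B C -> card_lt A C.
Proof.
move=> AB [BC nCB]; split; first exact: card_le_trans BC.
by move=> CA; apply/nCB/(card_le_trans CA).
Qed.

Lemma H_in lam x y : H lam x -> y ∈ x -> H lam y.
Proof.
move=> Hx yx; apply: card_lt_le Hx; apply: subset_card_le => z.
exact/trcl_trans/trcl_in.
Qed.

Lemma H_subset lam x y : H lam x -> elts y `<=` elts x -> H lam y.
Proof. by move=> Hx yx; apply: card_lt_le Hx; apply/subset_card_le/trcl_subset. Qed.

(** The form in which elementarity is used: the witness lies in [N], but its property still refers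
    to [D]. *)
Lemma elementary_ex N D Y e p : elementary N D Y -> (forall n, N (e n)) ->
    (exists2 x, D x & sat D Y (scons x e) p) ->
  exists2 x, N x & sat D Y (scons x e) p.
Proof.
move=> [_ ND el] Ne /(el (FEx p) e Ne) [x Nx xp]; exists x => //.
by apply/el => //; case.
Qed.

Definition FAll p := FNot (FEx (FNot p)).
Definition FImp p q := FNot (FAnd p (FNot q)).
Definition FOr p q := FNot (FAnd (FNot p) (FNot q)).

Lemma sat_and D Y e p q :
  sat D Y e (FAnd p q) <-> sat D Y e p /\ sat D Y e q.
Proof. by []. Qed.

Lemma sat_all D Y e p :
  sat D Y e (FAll p) <-> forall x, D x -> sat D Y (scons x e) p.
Proof.
split=> /= [nx x Dx|ap [x Dx]]; last by case; apply: ap.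
by apply: contrapT => np; apply: nx; exists x.
Qed.

Lemma sat_imp D Y e p q :
  sat D Y e (FImp p q) <-> (sat D Y e p -> sat D Y e q).
Proof.
split=> /= [npq sp|pq [sp]]; last by apply; apply: pq.
by apply: contrapT => nq; apply: npq.
Qed.

Lemma sat_or D Y e p q :
  sat D Y e (FOr p q) <-> (sat D Y e p \/ sat D Y e q).
Proof.
split=> /= [npq|[sp|sq] [] //]; apply: contrapT => n.
by apply: npq; split=> ?; apply: n; [left|right].
Qed.

Section Elementary.
Variables (lam : V) (Y : set V).
Hypothesis lam_ge : omega2 `<=` elts lam.

Lemma lam_uncountable : ~ countable (elts lam).
Proof.
move=> cl; apply: (omega1_uncountable lam_ge); apply: countable_sub cl.
by move=> x /omega1_omega2 /lam_ge.
Qed.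

Lemma countable_lt_lam (C : set V) : countable C -> card_lt C (elts lam).
Proof.
move=> cC; split; last by move=> le; apply: lam_uncountable; apply: sub_countable cC.
apply: card_le_trans cC _; apply/infiniteP => /finite_set_countable.
exact: lam_uncountable.
Qed.

(** An infinite [trcl x] absorbs [C]; if it is finite, the union is countable while [lam] is not. *)
Lemma H_of_countable x y (C : set V) : H lam x -> countable C ->
  trcl y `<=` trcl x `|` C -> H lam y.
Proof.
move=> Hx cC /subset_card_le le.
have [fin|inf] := pselect (finite_set (trcl x)).
  apply: (card_lt_le le); apply: countable_lt_lam.
  have -> : trcl x `|` C = \bigcup_(b in [set: bool]) if b then trcl x else C.
    apply/seteqP; split=> [z [?|?]|z [[] _ ?]]; [by exists true|by exists false|..].
    - by left.
    - by right.
  by apply: bigcup_countable => // -[] _ //; apply: finite_set_countable.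
exact: card_lt_le (card_le_trans le (card_setU_countable inf cC)) Hx.
Qed.

Variable M : V.
Hypothesis XM : XX lam Y M.

Let elM : elementary (elts M) (H lam) Y := XM.2.

Lemma XX_H x : x ∈ M -> H lam x.
Proof. by have [_ MH _] := elM; apply: MH. Qed.

Lemma XX_inter x y : x ∈ M -> y ∈ M -> inter x y ∈ M.
Proof.
move=> xM yM.
pose e n := if n is 0 then x else y.
have [||z zM] := @elementary_ex _ _ _ e
  (FAll (FAnd (FImp (FIn 0 1) (FAnd (FIn 0 2) (FIn 0 3)))
              (FImp (FAnd (FIn 0 2) (FIn 0 3)) (FIn 0 1)))) elM.
- by case.
- exists (inter x y); first by apply: H_subset (XX_H xM) _ => u /in_inter [].
  apply/sat_all => u _; split; apply/sat_imp => /= uxy; last exact/in_inter.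
  by apply/in_inter.
move=> /sat_all zP; suff -> : inter x y = z by [].
apply: V_ext => u; rewrite in_inter; split=> [uxy|uz].
  by have /sat_and [_ /sat_imp /(_ uxy)] := zP u (H_in (XX_H xM) uxy.1).
by have /sat_and [/sat_imp /(_ uz)] := zP u (H_in (XX_H zM) uz).
Qed.

(* The least ordinal outside c would have to belong to c. *)
Lemma inter_Lambda_notin b : Lambda b -> ~ inter M b ∈ M.
Proof.
move=> Lb; set c := inter M b => cM.
have ob := Lambda_ordinal Lb.
have cord : elts c `<=` ordinal by move=> x /in_inter [_ xb]; apply: ordinal_in xb.
have cc : countable (elts c) by apply: countable_sub XM.1 => x /in_inter [].
have [||d dM] := @elementary_ex _ _ _ (fun=> c)
  (* The formula asks for a transitive subset of [c] that is not in [c]; the least countable ordinal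
     outside [c] is one. *)
  (FAnd (FNot (FIn 0 1))
        (FAll (FImp (FIn 0 1)
           (FAnd (FIn 0 2) (FAll (FImp (FIn 0 1) (FIn 0 2))))))) elM.
- by [].
- have [a a1 ac] : exists2 a, omega1 a & ~ a ∈ c.
    apply: contrapT => na; apply: (omega1_uncountable lam_ge).
    by apply: countable_sub cc => a a1; apply: contrapT => ac; apply: na; exists a.
  have [d [[d1 dc] dmin]] := @least_ordinal (omega1 `\` elts c) a
    (fun x h => h.1.1) (conj a1 ac).
  have dsub : elts d `<=` elts c.
    move=> x xd; apply: contrapT => xc.
    have [|E|/(isin_asym xd)//] := dmin x; last by move: xd; rewrite E => /isin_irrefl.
    split=> //; split; first exact: ordinal_in d1.1 xd.
    by apply: countable_sub d1.2 => y yx; apply: ordinal_trans d1.1 xd yx.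
  exists d; first exact: H_subset (XX_H cM) dsub.
  split=> //; apply/sat_all => x _; apply/sat_imp => xd; split; first exact: dsub.
  by apply/sat_all => y _; apply/sat_imp => yx; apply: ordinal_trans d1.1 xd yx.
move=> /sat_and [dc /sat_all dP].
have Hd := XX_H dM.
have dP' x : x ∈ d -> x ∈ c /\ forall y, y ∈ x -> y ∈ d.
  move=> xd; have Hx := H_in Hd xd.
  have /sat_imp/(_ xd)/sat_and [xc /sat_all xP] := dP x Hx; split=> // y yx.
  by have /sat_imp := xP y (H_in Hx yx); apply.
(* The [d] found in [M] is a countable ordinal, so it lies below [b] and hence in [c]. *)
apply: dc; apply/in_inter; split=> //.
apply: (omega1_in_Lambda lam_ge Lb); split.
  by apply: ordinal_of_transitive => x /dP' [] // /cord.
by apply: countable_sub cc => x /dP' [].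
Qed.

Section Code.
Variables (K : V) (k : nat -> V).
Hypothesis kK : forall n, k n ∈ K.

Definition vpair x y := set_of (fun b : bool => if b then x else y).

Lemma in_vpair x y z : z ∈ vpair x y <-> z = x \/ z = y.
Proof.
by rewrite in_set_of; split=> [[[] <-]|[]->]; [left|right|exists true|exists false].
Qed.

Fixpoint code_seq n := if n is m.+1 then vpair (code_seq m) (k m) else K.

Lemma code_seq_trcl n m : trcl (code_seq (n + m).+1) (code_seq m).
Proof.
elim: n => [|n IH]; first by apply: trcl_in; apply/in_vpair; left.
by apply: trcl_trans IH; apply: trcl_in; apply/in_vpair; left.
Qed.

Lemma code_seq_inj : injective code_seq.
Proof.
suff lt m n : m < n -> code_seq m <> code_seq n.
  by move=> m n E; case: (ltngtP m n) => // /lt; rewrite E.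
move=> mn E; have := code_seq_trcl (n - m.+1) m.
by rewrite -addnS subnK // -E => mm; apply: (trcl_asym mm).
Qed.

(** Membership in [K] would close a cycle of the transitive closure. This tells the two entries of
    each pair apart: only [k m] is in [K]. *)
Lemma code_seq_notin n : ~ code_seq n ∈ K.
Proof.
case: n => [|n]; first exact: isin_irrefl.
by move=> /trcl_in /trcl_asym; have := code_seq_trcl n 0; rewrite addn0.
Qed.

Lemma code_seq_in m n : code_seq m ∈ code_seq n -> n = m.+1.
Proof.
case: n => [/code_seq_notin //|n] /in_vpair [/code_seq_inj -> //|E].
by have := kK n; rewrite -E => /code_seq_notin.
Qed.

End Code.

(* The countability of K is witnessed by f := {t_n | n}, where t_0 = K and     *)
(* t_{n+1} = {t_n, k_n} for an enumeration k of K: every t_{n+1} is definable  *)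
(* from t_n and f, and k_n from t_{n+1} and K, and the foundation axiom makes  *)
(* the induction on n available for every f satisfying the defining formula.   *)
Lemma XX_countable_sub K : K ∈ M -> countable (elts K) -> elts K `<=` elts M.
Proof.
move=> KM cK.
have [[x0 x0K]|nK] := pselect (exists x, x ∈ K); last by move=> x xK; case: nK; exists x.
have [D [k0 KE]] := countable_indexed x0 cK.
pose k n := if `[< D n >] then k0 n else x0.
have kK n : k n ∈ K.
  rewrite /k; case: asboolP => // Dn.
  have : elts K (k0 n) by rewrite KE; exists n.
  exact.
have kS x : x ∈ K -> exists n, k n = x.
  move=> xK; have : elts K x by [].
  by rewrite KE => -[n Dn <-]; exists n; rewrite /k asboolT.
pose t := code_seq K k.
have [||f fM] := @elementary_ex _ _ _ (fun=> K)
  (* The clauses: each element of [K] lies in some [u] in [f] that has an element in [f]; each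
     member of [f] is [K] or has an element in [f]; a member of [f] belongs to at most one member of
     [f]; a [u] in [f] that has an element in [f] has at most one element in [K]. *)
  (FAnd (FAll (FImp (FIn 0 2)
     (FEx (FEx (FAnd (FAnd (FIn 1 3) (FIn 0 3)) (FAnd (FIn 1 0) (FIn 2 0)))))))
  (FAnd (FAll (FImp (FIn 0 1) (FOr (FEq 0 2) (FEx (FAnd (FIn 0 2) (FIn 0 1))))))
  (FAnd (FAll (FAll (FAll (FImp (FAnd (FIn 2 3) (FAnd (FIn 1 3) (FIn 0 3)))
     (FImp (FAnd (FIn 2 1) (FIn 2 0)) (FEq 1 0))))))
        (FAll (FAll (FImp (FAnd (FAnd (FIn 1 2) (FIn 0 2)) (FIn 1 0))
           (FAll (FAll (FImp (FAnd (FAnd (FIn 1 2) (FIn 0 2)) (FAnd (FIn 1 5) (FIn 0 5)))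
              (FEq 1 0)))))))))) elM.
- by [].
- pose f := set_of t.
  have inf n : t n ∈ f by apply/in_set_of; exists n.
  have Hf : H lam f.
    apply: (H_of_countable (XX_H KM) (C := range t)).
      by apply: (sub_countable (card_image_le _ _)).
    apply: trcl_sub => [x /in_set_of [n <-]|y z [Ky zy|[n _ <-]]].
    + by right; exists n.
    + by left; apply: trcl_trans Ky (trcl_in zy).
    + case: n => [|n]; first by move=> /trcl_in; left.
      move=> /in_vpair [->|->]; first by right; exists n.
      by left; apply: trcl_in.
  exists f => //; split; last split; last split.
  + apply/sat_all => x _; apply/sat_imp => /= /kS [n <-].
    exists (t n); first exact: H_in Hf (inf n).
    exists (t n.+1); first exact: H_in Hf (inf n.+1).
    by split=> //; split; apply/in_vpair; [left|right].
  + apply/sat_all => x _; apply/sat_imp => xf; apply/sat_or.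
    case/in_set_of: (xf : x ∈ f) => -[|n] <-.
      by left.
    right; exists (t n); first exact: H_in Hf (inf n).
    by split=> //=; apply/in_vpair; left.
  + apply/sat_all => s _; apply/sat_all => u _; apply/sat_all => v _; apply/sat_imp.
    move=> [sf [uf vf]]; case/in_set_of: (sf : s ∈ f) => i <-.
    case/in_set_of: (uf : u ∈ f) => n <-; case/in_set_of: (vf : v ∈ f) => m <-.
    by apply/sat_imp => -[/= /(code_seq_in kK) -> /(code_seq_in kK) ->].
  + apply/sat_all => s _; apply/sat_all => u _; apply/sat_imp.
    move=> [[sf uf] su]; case/in_set_of: (sf : s ∈ f) su => i <-.
    case/in_set_of: (uf : u ∈ f) => n <- su.
    rewrite (code_seq_in kK (su : t i ∈ t n)).
    apply/sat_all => x _; apply/sat_all => y _; apply/sat_imp.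
    move=> [[/= /in_vpair [->|->] /in_vpair [->|->]] [iK iK']] //;
      by [have := code_seq_notin iK|have := code_seq_notin iK'].
move=> /sat_and [/sat_all fK /sat_and [/sat_all fpred /sat_and [/sat_all fsucc /sat_all fval]]].
have Hf := XX_H fM; have Hin x : x ∈ f -> H lam x by apply: H_in.
have fM' u : u ∈ f -> u ∈ M.
  elim/V_ind: u => u IH uf.
  have /sat_imp/(_ uf)/sat_or [/= -> //|[s _ /= [sf su]]] := fpred u (Hin _ uf).
  have sM := IH s su sf.
  have [||v vM [/= vf sv]] := @elementary_ex _ _ _ (fun n => if n is 0 then f else s)
    (FAnd (FIn 0 1) (FIn 2 0)) elM; first by case.
    by exists u => //; apply: Hin.
  suff -> : u = v by [].
  have /sat_all/(_ u (Hin _ uf))/sat_all/(_ v (Hin _ vf)) := fsucc s (Hin _ sf).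
  by move=> /sat_imp/(_ (conj sf (conj uf vf)))/sat_imp/(_ (conj su sv)).
move=> x xK; have Hx := H_in (XX_H KM) xK.
have /sat_imp/(_ xK) [s _ [u _ /= [[sf uf] [su xu]]]] := fK x Hx.
have [||y yM [/= yu yK]] := @elementary_ex _ _ _ (fun n => if n is 0 then u else K)
  (FAnd (FIn 0 1) (FIn 0 2)) elM; first by case=> //=; apply: fM'.
  by exists x.
suff -> : x = y by [].
have /sat_all/(_ u (Hin _ uf))/sat_imp := fval s (Hin _ sf).
move=> /(_ (conj (conj sf uf) su)) /sat_all/(_ x Hx)/sat_all/(_ y).
by move=> /(_ (XX_H yM))/sat_imp/(_ (conj (conj xu yu) (conj xK yK))).
Qed.

End Elementary.

(** * Comparison of models *)

Lemma is_beta_sym M N b : is_beta M N b -> is_beta N M b.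
Proof. by rewrite /is_beta setIC. Qed.

Lemma is_beta_uniq M N b c : is_beta M N b -> is_beta M N c -> b = c.
Proof.
move=> [Bb bmax] [Bc cmax]; have [->//|bc] := cmax _ Bb.
by have [->//|/(isin_asym bc)] := bmax _ Bc.
Qed.

Lemma is_beta_Lambda M N b : is_beta M N b -> Lambda b.
Proof. by move=> [[/Lambda_ofP []]]. Qed.

Lemma simX_sym M N : simX M N -> simX N M.
Proof. by move=> [b /is_beta_sym bb E]; exists b. Qed.

Lemma countable_inter M b : countable (elts M) -> countable (elts (inter M b)).
Proof. by apply: countable_sub => x /in_inter []. Qed.

Lemma isomorphic_trans Y M N P :
  isomorphic Y M N -> isomorphic Y N P -> isomorphic Y M P.
Proof.
move=> [s [sbij sin sY]] [t [tbij tin tY]]; exists (t \o s).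
have sMN x : x ∈ M -> s x ∈ N by move: x; case: sbij.
split=> [|a b aM bM|a aM]; first exact: set_bij_comp tbij.
- by rewrite sin //; apply: tin; apply: sMN.
- by rewrite sY //; apply: tY; apply: sMN.
Qed.

Section Models.
Variables (lam : V) (Y : set V).
Hypothesis lam_ge : omega2 `<=` elts lam.

(** Otherwise [N] would contain its own initial segment below a point of [Lambda]. *)
Lemma ltX_not_simX M N : XX lam Y N -> ltX M N -> ~ simX M N.
Proof.
move=> XN [b bb MbN] [c bc E]; have cb := is_beta_uniq bc bb; subst c.
by apply: (inter_Lambda_notin lam_ge XN (is_beta_Lambda bb)); rewrite -E.
Qed.

(** Each initial segment is a countable member of the other model, hence a subset of it, so the two
    coincide. *)
Lemma ltX_asym M N : XX lam Y M -> XX lam Y N -> ltX M N -> ~ ltX N M.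
Proof.
move=> XM XN MN [b /is_beta_sym bb NbM]; apply: (ltX_not_simX XN MN).
case: MN => c bc McN; have cb := is_beta_uniq bc bb; subst c; exists b => //.
have Nsub := XX_countable_sub lam_ge XM NbM (countable_inter b XN.1).
have Msub := XX_countable_sub lam_ge XN McN (countable_inter b XM.1).
apply: V_ext => x; split=> xb; apply/in_inter; split; try by case/in_inter: xb.
- exact: Msub.
- exact: Nsub.
Qed.

(* The shorter initial segment is cut off at the least element of the longer  *)
(* one outside b.                                                             *)
Lemma inter_initial M N b c : XX lam Y N -> countable (elts M) ->
  ordinal b -> ordinal c -> b = c \/ b ∈ c -> inter M c ∈ N -> inter M b ∈ N.
Proof.
move=> XN cM ob oc bc McN.
have bsub x : x ∈ b -> x ∈ c.
  by case: bc => [->//|bc xb]; apply: ordinal_trans bc xb.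
have McsubN := XX_countable_sub lam_ge XN McN (countable_inter c cM).
have oMc : elts (inter M c) `<=` ordinal.
  by move=> x /in_inter [_ /(ordinal_in oc)].
have [[y yMc yb]|sub] := pselect (exists2 y, y ∈ inter M c & ~ y ∈ b); last first.
  suff -> : inter M b = inter M c by [].
  apply: V_ext => x; rewrite !in_inter; split=> -[xM xb]; split=> //; first exact: bsub.
  by apply: contrapT => nxb; apply: sub; exists x => //; apply/in_inter.
have [d [[dMc db] dmin]] := @least_ordinal (elts (inter M c) `\` elts b) y
  (fun x h => oMc x h.1) (conj yMc yb).
have bd : d = b \/ b ∈ d by apply: ordinal_notin => //; apply: oMc.
suff -> : inter M b = inter (inter M c) d by exact: (XX_inter XN McN (McsubN _ dMc)).
apply: V_ext => x; rewrite !in_inter; split=> [[xM xb]|[[xM xc] xd]].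
  split; first by split=> //; apply: bsub.
  by case: bd => [->//|bd]; apply: ordinal_trans bd xb; apply: oMc.
split=> //; apply: contrapT => xb.
have [|E|/(isin_asym xd)//] := dmin x; first by split=> //; apply/in_inter.
by move: xd; rewrite E => /isin_irrefl.
Qed.

(** * Amalgamation of two conditions of the same type *)

(* The map sending eA n to eB n is an isomorphism between the unions of the   *)
(* conditions {MA i | i in I} and {MB i | i in I}; it is the identity on      *)
(* common elements, and every beta_{M,N} lies below the ordinals that the     *)
(* two unions do not share.                                                   *)
Record linked (I : set nat) (eA eB MA MB : nat -> V) : Prop := Linked {
  link_covA : forall i x, I i -> x ∈ MA i -> exists n, eA n = x;
  link_covB : forall i x, I i -> x ∈ MB i -> exists n, eB n = x;
  link_eq : forall m n, eA m = eA n <-> eB m = eB n;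
  link_in : forall m n, eA m ∈ eA n <-> eB m ∈ eB n;
  link_Y : forall n, Y (eA n) <-> Y (eB n);
  link_mem : forall i n, I i -> (eA n ∈ MA i <-> eB n ∈ MB i);
  link_countable : forall n, countable (elts (eA n)) <-> countable (elts (eB n));
  link_fix : forall m n, eA m = eB n -> eA m = eB m;
  link_beta : forall i j b n, I i -> I j -> Lambda_of (MA i) b ->
    Lambda_of (MB j) b -> eA n ∈ b \/ eB n ∈ b -> eA n = eB n }.

Lemma linked_sym I eA eB MA MB :
  linked I eA eB MA MB -> linked I eB eA MB MA.
Proof.
case=> covA covB eqL inL YL memL cntL fixL betaL; split=> //.
- by move=> m n; split=> /eqL.
- by move=> m n; split=> /inL.
- by move=> n; split=> /YL.
- by move=> i n Ii; split=> /memL; apply.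
- by move=> n; split=> /cntL.
- move=> m n E; have E' := fixL _ _ (esym E).
  by rewrite E; apply/eqL; rewrite E -E'.
- move=> i j b n Ii Ij Bi Aj nb; apply/esym/(betaL j i b n) => //.
  by case: nb; [right|left].
Qed.

Section Linked.
Variables (I : set nat) (eA eB MA MB : nat -> V).
Hypothesis L : linked I eA eB MA MB.
Hypothesis XA : forall i, I i -> XX lam Y (MA i).
Hypothesis XB : forall i, I i -> XX lam Y (MB i).

Lemma link_iso i : I i -> exists2 s, isomorphism Y (MA i) (MB i) s
  & forall n, s (eA n) = eB n.
Proof.
move=> Ii; pose s x := eB (xget 0%N [set n | eA n = x]).
have sE n : s (eA n) = eB n.
  apply/(link_eq L).
  exact: (@xgetPex _ 0%N [set m | eA m = eA n] (ex_intro _ n erefl)).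
exists s => //; split=> [|a b aM bM|a aM].
- split.
  + by move=> x xM; have [n E] := link_covA L Ii xM; subst x; rewrite /= sE; apply/(link_mem L).
  + move=> x y /set_mem xM /set_mem yM.
    have [n E] := link_covA L Ii xM; have [m E'] := link_covA L Ii yM; subst x y.
    by rewrite !sE => /(link_eq L).
  + move=> y yM; have [n E] := link_covB L Ii yM; subst y.
    by exists (eA n); rewrite ?sE //; apply/(link_mem L).
- have [n E] := link_covA L Ii aM; have [m E'] := link_covA L Ii bM; subst a b.
  by rewrite !sE; exact: (link_in L).
- by have [n E] := link_covA L Ii aM; subst a; rewrite sE; exact: (link_Y L).
Qed.

(** Countable members of a model are subsets of it, so the enumeration reaches all their
    elements. *)
Lemma link_elts i n y : I i -> eA n ∈ MA i -> countable (elts (eA n)) ->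
  y ∈ eB n <-> exists2 m, eB m = y & eA m ∈ eA n.
Proof.
move=> Ii nM cn; split=> [yn|[m <-] /(link_in L) //].
have nM' : eB n ∈ MB i by apply/(link_mem L).
have cn' : countable (elts (eB n)) by apply/(link_countable L).
have [m E] := link_covB L Ii (XX_countable_sub lam_ge (XB Ii) nM' cn' yn); subst y.
by exists m => //; apply/(link_in L).
Qed.

Lemma link_shared i K : I i -> K ∈ MA i -> countable (elts K) ->
  (forall n, eA n ∈ K -> eA n = eB n) -> K ∈ MB i.
Proof.
move=> Ii KM cK Kfix; have [n E] := link_covA L Ii KM; subst K.
suff -> : eA n = eB n by apply/(link_mem L).
have Ksub := XX_countable_sub lam_ge (XA Ii) KM cK.
apply: V_ext => y; rewrite (link_elts _ Ii KM cK); split=> [yn|[m <-] mn].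
  have [m E] := link_covA L Ii (Ksub _ yn); subst y.
  by exists m => //; rewrite Kfix.
by rewrite -Kfix.
Qed.

Lemma link_model i j n : I i -> I j -> eA n = MA i -> eA n ∈ MA j -> eB n = MB i.
Proof.
move=> Ii Ij E nM; have cn : countable (elts (eA n)) by rewrite E; case: (XA Ii).
apply: V_ext => y; rewrite (link_elts _ Ij nM cn) E; split=> [[m <- mn]|yM].
  by apply/(link_mem L).
have [m E'] := link_covB L Ii yM; subst y; exists m => //.
by apply/(link_mem L).
Qed.

Lemma link_inter i j k b : I i -> I j -> I k -> Lambda_of (MA i) b ->
  Lambda_of (MB j) b -> inter (MA k) b = inter (MB k) b.
Proof.
move=> Ii Ij Ik Ai Bj; apply: V_ext => x; rewrite !in_inter; split=> -[xM xb].
- have [n E] := link_covA L Ik xM; subst x; split=> //.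
  by rewrite (link_beta L Ii Ij Ai Bj (or_introl xb)); apply/(link_mem L).
- have [n E] := link_covB L Ik xM; subst x; split=> //.
  by rewrite -(link_beta L Ii Ij Ai Bj (or_intror xb)); apply/(link_mem L).
Qed.

(** Membership in [Lambda_of] depends only on the part below [b], where [MA i] and [MB i] agree. *)
Lemma link_Lambda_of i j b : I i -> I j -> Lambda_of (MA i) b ->
  Lambda_of (MB j) b -> Lambda_of (MB i) b.
Proof.
move=> Ii Ij Ai Bj; have E := link_inter Ii Ij Ii Ai Bj.
have /Lambda_ofP [Lb bP] := Ai; apply/Lambda_ofP; split=> // d Ld db.
have [x xM [xb dx]] := bP d Ld db; exists x => //.
by have /in_inter [] : x ∈ inter (MB i) b by rewrite -E; apply/in_inter.
Qed.

Hypothesis ch : CH.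

Lemma link_beta_le i j c : I i -> I j -> is_beta (MB i) (MB j) c ->
  exists b, [/\ is_beta (MA i) (MB j) b, b = c \/ b ∈ c,
    ordinal b, ordinal c & forall k, I k -> inter (MA k) b = inter (MB k) b].
Proof.
move=> Ii Ij bc; have [b bb] := beta_exists lam_ge ch (MB j) (XA Ii).1.
have [[Ai Bj] _] := bb; exists b; split=> //.
- by case: bc => _; apply; split=> //; exact: (link_Lambda_of Ii Ij Ai Bj).
- exact: Lambda_ordinal (is_beta_Lambda bb).
- exact: Lambda_ordinal (is_beta_Lambda bc).
- by move=> k Ik; exact: (link_inter Ii Ij Ik Ai Bj).
Qed.

Lemma link_ltX i j : I i -> I j -> ltX (MB i) (MB j) -> ltX (MA i) (MB j).
Proof.
move=> Ii Ij [c bc McN]; have [b [bb le_bc ob oc E]] := link_beta_le Ii Ij bc.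
exists b => //; rewrite E //.
exact: (inter_initial (XB Ij) (XB Ii).1 ob oc le_bc McN).
Qed.

Lemma link_simX i j : I i -> I j -> simX (MB i) (MB j) -> simX (MA i) (MB j).
Proof.
move=> Ii Ij [c bc Ec]; have [b [bb le_bc ob oc E]] := link_beta_le Ii Ij bc.
have sub x : x ∈ b -> x ∈ c.
  by case: le_bc => [->//|bc' xb]; apply: ordinal_trans bc' xb.
exists b => //; rewrite E //; apply: V_ext => x; rewrite !in_inter.
split=> -[xM xb]; split=> //.
- by have /in_inter [] : x ∈ inter (MB j) c by rewrite -Ec; apply/in_inter; auto.
- by have /in_inter [] : x ∈ inter (MB i) c by rewrite Ec; apply/in_inter; auto.
Qed.

End Linked.

(** * Adequacy and coherence for pairs taken from both conditions *)

Section Transfer.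
Variables (I : set nat) (eA eB MA MB : nat -> V).
Hypothesis L : linked I eA eB MA MB.
Hypothesis XA : forall i, I i -> XX lam Y (MA i).
Hypothesis XB : forall i, I i -> XX lam Y (MB i).
Hypothesis ch : CH.

(** Here the segment of [MB j] must move from [MB i] into [MA i]: it is countable and all its
    elements are fixed, so [link_shared] applies. *)
Lemma link_gtX i j : I i -> I j -> ltX (MB j) (MB i) -> ltX (MB j) (MA i).
Proof.
move=> Ii Ij [c /is_beta_sym bc NcM].
have [b [bb le_bc ob oc E]] := link_beta_le L XA ch Ii Ij bc.
have [[Ai Bj] _] := bb; exists b; first exact: is_beta_sym.
have NbM := inter_initial (XB Ii) (XB Ij).1 ob oc le_bc NcM.
apply: (link_shared (linked_sym L) XB XA Ii NbM).
  by apply: countable_inter; case: (XB Ij).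
move=> n /in_inter [_ nb]; apply/esym.
exact: (link_beta L Ii Ij Ai Bj (or_intror nb)).
Qed.

Lemma link_adequate i j : I i -> I j -> adequate (MB @` I) ->
  [\/ ltX (MA i) (MB j), simX (MA i) (MB j) | ltX (MB j) (MA i)].
Proof.
move=> Ii Ij adB; have [||c|c|c] := adB (MB i) (MB j).
- by exists i.
- by exists j.
- by apply: Or31; apply: (link_ltX L).
- by apply: Or32; apply: (link_simX L).
- by apply: Or33; apply: link_gtX.
Qed.

(** Adequacy compares [MB i] and [MB j]; any other outcome would transfer to [MA i] and contradict
    exclusivity. *)
Lemma link_simX_inv i j : I i -> I j -> adequate (MB @` I) ->
  simX (MA i) (MB j) -> simX (MB i) (MB j).
Proof.
move=> Ii Ij adB MN; have [||/(link_ltX L XA XB ch Ii Ij)|//|/(link_gtX Ii Ij)] := adB (MB i) (MB j).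
- by exists i.
- by exists j.
- by move=> /(ltX_not_simX (XB Ij)).
- by move=> /(ltX_not_simX (XA Ii)) []; apply: simX_sym.
Qed.

Lemma link_ltX_inv i j : I i -> I j -> adequate (MB @` I) ->
  ltX (MA i) (MB j) -> ltX (MB i) (MB j).
Proof.
move=> Ii Ij adB MN; have [||//|/(link_simX L XA ch Ii Ij)|/(link_gtX Ii Ij)] := adB (MB i) (MB j).
- by exists i.
- by exists j.
- by move=> /(ltX_not_simX (XB Ij) MN).
- by move=> /(ltX_asym (XA Ii) (XB Ij) MN).
Qed.

Hypothesis cohB : coherent_adequate Y (MB @` I).

(** The isomorphism goes through [MB i]: a common element is fixed by the link, hence lies in [MB i]
    as well, and is then fixed by the second map. *)
Lemma link_strong i j : I i -> I j -> simX (MA i) (MB j) ->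
  strongly_isomorphic Y (MA i) (MB j).
Proof.
move=> Ii Ij; have [adB co1 _ _] := cohB; move=> /(link_simX_inv Ii Ij adB).
move=> /co1 [||t [tbij tin tY] tfix]; [by exists i|by exists j|].
have [s [sbij sin sY] sE] := link_iso L Ii.
have sMN x : x ∈ MA i -> s x ∈ MB i by move: x; case: sbij.
exists (t \o s); first split=> [|a b aM bM|a aM].
- exact: set_bij_comp tbij.
- by rewrite sin //; apply: tin; apply: sMN.
- by rewrite sY //; apply: tY; apply: sMN.
move=> a aM aN; have [m Em] := link_covA L Ii aM; have [n En] := link_covB L Ij aN.
subst a; have fm := link_fix L (esym En).
rewrite /= sE fm tfix //; last by rewrite -fm.
by apply/(link_mem L).
Qed.

Lemma link_reflect i j : I i -> I j -> ltX (MA i) (MB j) ->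
  exists N', [/\ (MA @` I) N', isomorphic Y N' (MB j) & MA i ∈ N'].
Proof.
move=> Ii Ij; have [adB _ co2 _] := cohB; move=> /(link_ltX_inv Ii Ij adB).
move=> /co2 [||_ [[k Ik <-] isoN MN]]; [by exists i|by exists j|].
exists (MA k); split; first by exists k.
  by apply: isomorphic_trans isoN; have [s] := link_iso L Ik; exists s.
have [n En] := link_covB L Ik MN.
have nM : eB n ∈ MB k by rewrite En.
rewrite -(link_model (linked_sym L) XB XA Ii Ik En nM).
by apply/(link_mem L).
Qed.

(** Precomposing [s] with the link gives an isomorphism inside the second condition, which carries
    the counterpart of [K] to [s K]. *)
Lemma link_push i j s K : I i -> I j -> isomorphism Y (MA i) (MB j) s ->
  K ∈ MA i -> (MA @` I) K -> (MB @` I) (s K).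
Proof.
move=> Ii Ij [sbij sin sY] KM [k Ik EK]; subst K; have [_ _ _ co3] := cohB.
have [n En] := link_covA L Ii KM.
have nM : eA n ∈ MA i by rewrite En.
have Ek := link_model L XA XB Ik Ii En nM.
have [t [tbij tin tY] tE] := link_iso (linked_sym L) Ii.
have tMN x : x ∈ MB i -> t x ∈ MA i by move: x; case: tbij.
have -> : s (MA k) = (s \o t) (MB k) by rewrite /= -Ek tE En.
apply: (co3 (MB i) (MB j)); [by exists i|by exists j| | |by exists k].
  split=> [|a b aM bM|a aM]; first exact: set_bij_comp sbij.
  - by rewrite tin //; apply: sin; apply: tMN.
  - by rewrite tY //; apply: sY; apply: tMN.
by rewrite -Ek; apply/(link_mem L).
Qed.

(** As a countable member of [MA i], the model [MB k] consists of common elements; these are fixed,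
    so it equals [MA k]. *)
Lemma link_common i K : I i -> K ∈ MA i -> (MB @` I) K -> (MA @` I) K.
Proof.
move=> Ii KM [k Ik EK]; subst K; exists k => //.
have Ksub := XX_countable_sub lam_ge (XA Ii) KM (XB Ik).1.
have Kfix n : eB n ∈ MB k -> eB n = eA n.
  move=> nM; have [m Em] := link_covA L Ii (Ksub _ nM).
  exact: (link_fix (linked_sym L) (esym Em)).
apply: V_ext => x; split=> xM.
  have [n En] := link_covA L Ik xM; subst x.
  have nB : eB n ∈ MB k by apply/(link_mem L).
  by rewrite -Kfix.
have [n En] := link_covB L Ik xM; subst x.
by rewrite Kfix //; apply/(link_mem L).
Qed.

End Transfer.

Lemma linked_union I eA eB MA MB : CH -> linked I eA eB MA MB ->
    (forall i, I i -> XX lam Y (MA i)) -> (forall i, I i -> XX lam Y (MB i)) ->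
    coherent_adequate Y (MA @` I) -> coherent_adequate Y (MB @` I) ->
  coherent_adequate Y (MA @` I `|` MB @` I).
Proof.
move=> ch L XA XB cohA cohB; have L' := linked_sym L.
have [adA A1 A2 A3] := cohA; have [adB B1 B2 B3] := cohB.
split.
- move=> M N [AM|BM] [AN|BN].
  + exact: adA.
  + case: AM BN => i Ii <- [j Ij <-]; exact: (link_adequate L).
  + case: BM AN => i Ii <- [j Ij <-]; exact: (link_adequate L').
  + exact: adB.
- move=> M N [AM|BM] [AN|BN].
  + exact: A1.
  + case: AM BN => i Ii <- [j Ij <-]; exact: (link_strong L).
  + case: BM AN => i Ii <- [j Ij <-]; exact: (link_strong L').
  + exact: B1.
- move=> M N [AM|BM] [AN|BN] MN.
  + by have [N' [? ? ?]] := A2 M N AM AN MN; exists N'; split=> //; left.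
  + case: AM BN MN => i Ii <- [j Ij <-] MN.
    by have [N' [? ? ?]] := link_reflect L XA XB ch cohB Ii Ij MN; exists N'; split=> //; left.
  + case: BM AN MN => i Ii <- [j Ij <-] MN.
    by have [N' [? ? ?]] := link_reflect L' XB XA ch cohA Ii Ij MN; exists N'; split=> //; right.
  + by have [N' [? ? ?]] := B2 M N BM BN MN; exists N'; split=> //; right.
- move=> M N s K MM NN iso KM KK.
  have inA : (MA @` I) M -> (MA @` I) K.
    by move=> [i Ii EM]; subst M; case: KK => // KB; apply: (link_common L XA XB Ii KM).
  have inB : (MB @` I) M -> (MB @` I) K.
    by move=> [i Ii EM]; subst M; case: KK => // KB; apply: (link_common L' XB XA Ii KM).
  case: MM NN => [AM|BM] [AN|BN].
  + by left; apply: A3 iso KM (inA AM).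
  + right; have AK := inA AM; case: AM BN => i Ii EM [j Ij EN]; subst M N.
    exact: (link_push L XA XB cohB Ii Ij iso KM AK).
  + left; have BK := inB BM; case: BM AN => i Ii EM [j Ij EN]; subst M N.
    exact: (link_push L' XB XA cohA Ii Ij iso KM BK).
  + by right; apply: B3 iso KM (inB BM).
Qed.

End Models.

(** * The chain condition *)

Lemma least_uniq (P : set V) a b : least P a -> least P b -> a = b.
Proof.
move=> [Pa amin] [Pb bmin]; have [//|ba] := bmin _ Pa.
by have [//|/(isin_asym ba)] := amin _ Pb.
Qed.

Definition code_rel (R : nat -> nat -> Prop) : set nat :=
  [set k | exists m n, k = pickle (m, n) /\ R m n].

Lemma code_relP R R' m n : code_rel R = code_rel R' -> R m n <-> R' m n.
Proof.
suff sub Q Q' : code_rel Q = code_rel Q' -> Q m n -> Q' m n by split; apply: sub.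
move=> E Qmn; have : code_rel Q (pickle (m, n)) by exists m, n.
by rewrite E => -[m' [n' [/(pcan_inj pickleK) [-> ->]]]].
Qed.

Section Chain.
Variables (lam : V) (Y : set V).
Hypothesis lam_ge : omega2 `<=` elts lam.
Hypothesis ch : CH.

(* The type of the condition {M i | i in I} whose union is enumerated by e.   *)
Definition cond_type (I : set nat) (M e : nat -> V) (k : nat) : set nat :=
  match k with
  | 0 => I
  | 1 => code_rel (fun m n => e m = e n)
  | 2 => code_rel (fun m n => e m ∈ e n)
  | 3 => [set n | Y (e n)]
  | 4 => code_rel (fun i n => e n ∈ M i)
  | _ => [set n | countable (elts (e n))]
  end.

Lemma condition_enum (A : set V) : PP lam Y A ->
  exists (I : set nat) (M e : nat -> V), A = M @` I /\
    forall i x, I i -> x ∈ M i -> exists n, e n = x.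
Proof.
move=> [finA AX _].
have cA := finite_set_countable finA.
have [I [M AE]] := countable_indexed vempty cA.
have cU : countable (\bigcup_(N in A) elts N).
  by apply: bigcup_countable => // N /AX [].
have [e eU] := countable_enum vempty cU.
exists I, M, e; split=> // i x Ii xM.
by have [|n _ <-] := eU x; [exists (M i) => //; rewrite AE; exists i|exists n].
Qed.

Lemma PP_cc : omega2_cc (PP lam Y) (fun B A => A `<=` B).
Proof.
move=> W [WP anti]; apply: contrapT => Wbig.
have /choice [D DP] : forall A : set V, exists d : set nat * (nat -> V) * (nat -> V),
    W A -> A = d.1.2 @` d.1.1 /\
      forall i x, d.1.1 i -> x ∈ d.1.2 i -> exists n, d.2 n = x.
  move=> A; have [WA|?] := pselect (W A); last by exists (set0, fun=> vempty, fun=> vempty).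
  by have [I [M [e h]]] := condition_enum (WP _ WA); exists (I, M, e).
pose I A := (D A).1.1; pose M A := (D A).1.2; pose e A := (D A).2.
pose ty A := cond_type (I A) (M A) (e A).
have [p pP] := omega2_enum ch.
have /choice [la laP] (f : nat -> V) :
    exists b, least (Lambda `\` osup (range f `&` omega2)) b.
  by apply: (Lambda_least_above lam_ge ch); apply: (sub_countable (card_image_le _ _)).
(* The values at indices in [d] are prescribed by [f]; the last clause keeps the remaining ordinals
   at or above [la f]. *)
pose fits (d : set nat) t (f : nat -> V) A := [/\ W A, ty A = t,
  forall n, d n -> e A n = f n &
  forall n, ~ d n -> omega2 (e A n) -> ~ e A n ∈ la f].
have /choice [pk pkP] : forall x : set nat * (nat -> set nat) * (nat -> V),
    exists A, (exists B, fits x.1.1 x.1.2 x.2 B) -> fits x.1.1 x.1.2 x.2 A.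
  move=> x; have [[B xB]|?] := pselect (exists B, fits x.1.1 x.1.2 x.2 B).
    by exists B.
  by exists set0.
pose pick d t f := pk (d, t, f).
(* Operation 0 yields elements of ordinals, 1 yields [la], and [k'.+2] the [k']-th element of the
   picked condition; [l] holds [d] followed by the type. *)
pose F k (l : nat -> set nat) f :=
  match k with
  | 0 => p (f 0) (l 0)
  | 1 => la f
  | k'.+2 => e (pick (l 0) (fun i => l i.+1) f) k'
  end.
pose S := generated F vempty.
have S0 : S vempty := generated_seed F vempty.
have Str a x : S a -> omega2 a -> x ∈ a -> S x.
  move=> Sa oa xa; have [l <-] := pP _ _ oa xa.
  exact: (@generated_op F vempty 0 (fun=> l) (fun=> a)).
have Sla f : (forall n, S (f n)) -> S (la f).
  exact: (@generated_op F vempty 1 (fun=> set0) f).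
pose pickw w := if w is Node k l f then
  pick (l 0) (fun i => l i.+1) (fun n => weval F vempty (f n)) else set0.
have [B WB npB] : exists2 B, W B & ~ range pickw B.
  apply: contrapT => nB; apply: Wbig.
  apply: (card_le_trans (B := [set: wtree])).
    apply: (@surj_card_le _ _ _ _ pickw) => B WB; apply: contrapT => npB.
    by apply: nB; exists B.
  exact: card_le_trans card_wtree (reals_le_omega1 ch).
pose d : set nat := [set n | S (e B n)].
pose f n := if `[< d n >] then e B n else vempty.
have fd n : d n -> f n = e B n by move=> dn; rewrite /f asboolT.
have Sf n : S (f n) by rewrite /f; case: asboolP.
have [[Lla nla] lamin] := laP f.
have ola := Lambda_omega2 Lla.
(* An ordinal of [B] below [la f] is in [S], since [la f] is; so its index is in [d]. *)
have fitB : fits d (ty B) f B.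
  split=> // [n /fd //|n dn on nla']; apply: dn.
  exact: Str (Sla _ Sf) ola nla'.
pose A := pick d (ty B) f.
have [WA tyA eAd eAnd] : fits d (ty B) f A.
  by apply: (pkP (d, ty B, f)); exists B.
pose l i := if i is j.+1 then ty B j else d.
have SA n : S (e A n) by apply: (@generated_op F vempty n.+2 l f).
have AB : A <> B.
  move=> AB; apply: npB; rewrite -AB.
  have /choice [g gP] n : exists w, weval F vempty w = f n by have [w] := Sf n; exists w.
  exists (Node 0 l g) => //=; congr pick; apply/funext => n.
  exact: gP.
have [EA covA] := DP A WA; have [EB covB] := DP B WB.
have EI : I A = I B by apply: (congr1 (fun t => t 0%N) tyA).
have EA' : A = M A @` I B by rewrite -EI.
have inA i : I B i -> A (M A i).
  by move=> Ii; have /seteqP [_ sub] := EA'; apply: sub; exists i.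
have inB i : I B i -> B (M B i).
  by move=> Ii; have /seteqP [_ sub] := EB; apply: sub; exists i.
have [finA AX cohA] := WP A WA; have [finB BX cohB] := WP B WB.
have eqL m n : e A m = e A n <-> e B m = e B n.
  exact: code_relP (congr1 (fun t => t 1%N) tyA).
have L : linked Y (I B) (e A) (e B) (M A) (M B).
  split=> //.
  - by rewrite -EI.
  - by move=> m n; apply: code_relP (congr1 (fun t => t 2) tyA).
  - by move=> n; have := congr1 (fun t => t 3 n) tyA => /= ->.
  - by move=> i n _; apply: (@code_relP (fun i n => e A n ∈ M A i)
      (fun i n => e B n ∈ M B i)); apply: (congr1 (fun t => t 4) tyA).
  - by move=> n; have := congr1 (fun t => t 5 n) tyA => /= ->.
  - move=> m n E; have dn : d n by rewrite /d /= -E; apply: SA.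
    by rewrite E; apply/esym/eqL; rewrite E eAd ?fd.
  - move=> i j b n Ii Ij Ai Bj.
    have /Lambda_ofP [Lb _] := Ai; have ob := Lambda_omega2 Lb.
    (* The point [b] is [la] of an enumeration of the part of [M A i] below it, which lies in [S];
       the filler [vempty] adds nothing to the supremum. *)
    have Sb : S b.
      have cMb : countable (elts (M A i) `&` elts b).
        have [cM _] : XX lam Y (M A i) by apply/AX/inA.
        by apply: countable_sub cM => x [].
      have [G [g0 gE]] := countable_indexed vempty cMb.
      pose g m := if `[< G m >] then g0 m else vempty.
      have gin m : G m -> (elts (M A i) `&` elts b) (g0 m) by rewrite gE; exists m.
      have Sg m : S (g m).
        have IAi : I A i by rewrite EI.
        by rewrite /g; case: asboolP => // /gin [/(covA i _ IAi) [m' <-] _]; apply: SA.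
      suff -> : b = la g by apply: Sla.
      apply: least_uniq (laP g); rewrite (_ : osup _ = osup (elts (M A i) `&` elts b)) //.
      apply/seteqP; split=> [y [x [[m _ <-] _]]|y [x xb yx]].
        rewrite /g; case: asboolP => [Gm yg|_ /in_vempty //].
        by exists (g0 m) => //; apply: gin.
      exists x => //; split; last by apply: omega2_in ob xb.2.
      by move: xb; rewrite gE => -[m Gm <-]; exists m; rewrite // /g asboolT.
    have dB m : e B m ∈ b -> d m by move=> mb; apply: Str Sb ob mb.
    case=> [nb|/dB dn]; last by rewrite eAd ?fd.
    suff dn : d n by rewrite eAd ?fd.
    apply: contrapT => /eAnd; apply; first exact: omega2_in ob nb.
    (* The points of [M B j] below [b] are in [S], hence values of [f], so [la f] is not below their
       supremum and minimality of [b] applies. Thus [e A n] is below [la f], against the last clause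
       of [fits]. *)
    have [E|bla] : la f = b \/ b ∈ la f.
    - case: Bj => _; apply; split=> // -[x [xM xb] lax]; apply: nla; exists x => //.
      split; last exact: omega2_in ob xb.
      have [m Em] := covB _ _ Ij xM; subst x; exists m => //.
      by rewrite fd //; apply: dB.
    - by rewrite E.
    - by apply: ordinal_trans bla nb; apply: Lambda_ordinal.
apply: (anti A B) => //; exists (A `|` B); split; [|by left|by right].
split=> [|N [/AX|/BX]//|]; first by rewrite finite_setU.
rewrite [X in X `|` _]EA' [X in _ `|` X]EB.
apply: (linked_union lam_ge ch L) => [i /inA /AX //|i /inB /BX //||].
- by rewrite -EA'.
- by rewrite -EB.
Qed.

End Chain.

Unset Implicit Arguments.

Theorem theorem8p3 (lam : V) (Y : set V)
  (lam_card : cardinal lam) (lam_ge : omega2 `<=` elts lam)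
  (lam_cof : uncountable_cofinality lam)
  (Y_sub : Y `<=` H lam) (Y_codes : codes_well_order (H lam) Y)
  (ch : CH) :
  omega2_cc (PP lam Y) (fun B A => A `<=` B).
Proof. exact: PP_cc. Qed.
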